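(* Let $n,N,l$ be positive integers, let $A_1,\ldots,A_N,B_1,\ldots,B_N\in\mathbb{R}^{n\times n}$ be (entrywise) nonnegative matrices, and let $f:\mathbb{R}^n\to\mathbb{R}^n$ be an admissible diagonal nonlinearity. Assume that there exist numbers $\mu>0$, $\lambda>0$ and vectors $d^{(1)}\gg 0,\ldots,d^{(N)}\gg 0$, $\theta\gg 0$ in $\mathbb{R}^n$ such that $$A_s^Td^{(r)}+B_m^Td^{(j)}\le\mu d^{(s)},\qquad s,r,m,j=1,\ldots,N,$$ $$(A_s+B_s)\theta\le\lambda\theta,\qquad s=1,\ldots,N,$$ $$\lambda\mu<1.$$ Then there exists a switched diagonal Lyapunov--Krasovskii functional of the form $$\widetilde V(k,x^{(k)})=x^T(k)P^{(\sigma(k))}x(k)+x^T(k-1)Q_1x(k-1)+\ldots+x^T(k-l)Q_lx(k-l),$$ with $P^{(1)},\ldots,P^{(N)},Q_1,\ldots,Q_l$ positive definite diagonal matrices, for the switched system $$x(k+1)=f\left(A_{\sigma(k)}x(k)+B_{\sigma(k)}x(k-l)\right).$$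
   Context: Vector inequalities are componentwise: $v\le w$ means $v_i\le w_i$ for all $i$, and $v\gg 0$ means $v_i>0$ for all $i$. An admissible diagonal nonlinearity is a continuous map $f:\mathbb{R}^n\to\mathbb{R}^n$ of the form $f(x)=(f_1(x_1),\ldots,f_n(x_n))^T$ such that for each $i$: $x_if_i(x_i)>0$ for all $x_i\ne 0$, and $|f_i(x_i)|\le|x_i|$ for all $x_i$. The switching signal $\sigma$ maps the nonnegative integers to $\{1,\ldots,N\}$ and is arbitrary. Write $x^{(k)}=(x^T(k),x^T(k-1),\ldots,x^T(k-l))^T\in\mathbb{R}^{(l+1)n}$. $\widetilde V$ is a switched diagonal Lyapunov--Krasovskii functional for the switched system if its difference $\widetilde V(k+1,x^{(k+1)})-\widetilde V(k,x^{(k)})$ along trajectories of the switched system is negative, for every switching signal $\sigma$, every $k\ge 0$ and every $x^{(k)}\ne 0$; the matrices $P^{(s)},Q_m$ do not depend on $\sigma$. *)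

(* Defs.v *)
From HB Require Import structures.
From mathcomp Require Import all_boot all_order all_algebra.
From mathcomp Require Import all_classical all_reals all_analysis.
Set Implicit Arguments.
Unset Strict Implicit.
Unset Printing Implicit Defensive.
Import Order.TTheory GRing.Theory Num.Theory numFieldNormedType.Exports.
Local Open Scope ring_scope.

Definition vle (R : realType) (n : nat) (v w : 'cV[R]_n) : Prop :=
  forall i, v i 0 <= w i 0.

Definition vpos (R : realType) (n : nat) (v : 'cV[R]_n) : Prop :=
  forall i, 0 < v i 0.

Definition nonneg_mx (R : realType) (n : nat) (A : 'M[R]_n) : Prop :=
  forall i j, 0 <= A i j.

Definition admissible (R : realType) (n : nat) (f : 'cV[R]_n -> 'cV[R]_n)
    : Prop :=
  continuous f /\
  exists phi : 'I_n -> R -> R,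
    (forall x, f x = \col_i phi i (x i 0)) /\
    (forall i t, t != 0 -> 0 < t * phi i t) /\
    (forall i t, `|phi i t| <= `|t|).

Definition qform (R : realType) (n : nat) (P : 'M[R]_n) (v : 'cV[R]_n) : R :=
  (v^T *m P *m v) 0 0.

(* Symmetry is not required separately: a diagonal matrix is symmetric. *)
Definition posdef_diag (R : realType) (n : nat) (P : 'M[R]_n) : Prop :=
  is_diag_mx P /\ forall v : 'cV[R]_n, v != 0 -> 0 < qform P v.

(* Time is an [int] so that the initial segment x(k0), ..., x(k0 - l) may
   have negative arguments; values of x before time k0 - l are irrelevant. *)
Definition trajectory (R : realType) (n N l : nat)
    (f : 'cV[R]_n -> 'cV[R]_n) (A B : 'I_N -> 'M[R]_n)
    (sigma : nat -> 'I_N) (k0 : nat) (x : int -> 'cV[R]_n) : Prop :=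
  forall k : nat, (k0 <= k)%N ->
    x (k%:Z + 1) =
      f (A (sigma k) *m x k%:Z + B (sigma k) *m x (k%:Z - l%:Z)).

(* x^(k), the stacked vector of dimension (l+1)n; block i is x(k - i). *)
Definition history (R : realType) (n l : nat) (x : int -> 'cV[R]_n) (k : nat)
    : 'cV[R]_(\sum_(i < l.+1) n) :=
  \mxcol_(i < l.+1) x (k%:Z - i%:Z).

(* The ordinal m : 'I_l stands for the index m + 1 in {1, ..., l}, so [Q m]
   is Q_(m+1) and is paired with block m + 1 of X, which is x(k - (m+1)). *)
Definition LKfun (R : realType) (n N l : nat) (P : 'I_N -> 'M[R]_n)
    (Q : 'I_l -> 'M[R]_n) (sigma : nat -> 'I_N) (k : nat)
    (X : 'cV[R]_(\sum_(i < l.+1) n)) : R :=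
  qform (P (sigma k)) (submxcol X ord0) +
  \sum_(m < l) qform (Q m) (submxcol X (lift ord0 m)).

(* Trajectories may start at any time k0 with any initial segment, so that
   (taking k0 = k) x^(k) ranges over all nonzero vectors at every k. *)
Definition is_switched_LK (R : realType) (n N l : nat)
    (f : 'cV[R]_n -> 'cV[R]_n) (A B : 'I_N -> 'M[R]_n)
    (V : (nat -> 'I_N) -> nat -> 'cV[R]_(\sum_(i < l.+1) n) -> R) : Prop :=
  forall (sigma : nat -> 'I_N) (k0 : nat) (x : int -> 'cV[R]_n),
    trajectory l f A B sigma k0 x ->
    forall k : nat, (k0 <= k)%N -> history l x k != 0 ->
      V sigma k.+1 (history l x k.+1) - V sigma k (history l x k) < 0.

(* Main.v *)
Require Import Defs.
From HB Require Import structures.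
From mathcomp Require Import all_boot all_order all_algebra.
From mathcomp Require Import all_classical all_reals all_analysis.
From mathcomp Require Import ring lra zify.
Import Order.TTheory GRing.Theory Num.Theory numFieldNormedType.Exports.
Local Open Scope ring_scope.

(** Put p^(s)_i = d^(s)_i / theta_i for the diagonal of P^(s).  Since
    (A_s + B_s) theta <= lambda theta and |f_i(t)| <= |t|, the Schur test
    [schur_test], applied to the block row (A_s B_s), bounds the first term of
    the functional at time k+1:
      sum_i d^(r)_i / theta_i * x_i(k+1)^2
        <= sum_i (lambda A_s^T d^(r))_i / theta_i * x_i(k)^2
         + sum_i (lambda B_s^T d^(r))_i / theta_i * x_i(k-l)^2.
    The functional therefore decreases as soon as, for each coordinate i, the
    diagonal entries c_i(m) / theta_i of Q_m, continued to m = 0 and m = l+1,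
    decrease strictly in m and satisfy
      c_i(0) <= d^(s)_i - lambda (A_s^T d^(r))_i   and
      lambda (B_m^T d^(j))_i <= c_i(l+1):
    the difference is then at most
    sum_i sum_(m <= l) (c_i(m+1) - c_i(m)) / theta_i * x_i(k-m)^2.

    Such c_i exist because every right-hand side of the first family exceeds
    every left-hand side of the second, which is what
    lambda (A_s^T d^(r) + B_m^T d^(j)) <= lambda mu d^(s) << d^(s) says; the
    finitely many matrices leave a nondegenerate interval, in which
    [decreasing_between] places an arithmetic progression.  That the two pairs
    of indices (s, r) and (m, j) vary independently is what makes the Q_m
    independent of the switching signal. *)

(** The progression runs down from the least b to the greatest a. *)
Lemma decreasing_between (R : realFieldType) (I J : finType) (i0 : I) (j0 : J)
    (a : I -> R) (b : J -> R) (l : nat) :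
    (forall i j, a i < b j) ->
  exists c : nat -> R,
    [/\ forall m m', (m < m')%N -> c m' < c m,
        forall j, c 0%N <= b j & forall i, a i <= c l.+1].
Proof.
move=> ab.
case: (arg_maxP a (erefl : xpredT i0)) => i _ imax.
case: (arg_minP b (erefl : xpredT j0)) => j _ jmin.
exists (fun m => b j - (b j - a i) * (m%:R / l.+1%:R)); split.
- move=> m m' lt_mm'.
  rewrite ltrD2l ltrN2 ltr_pM2l ?subr_gt0 //.
  by rewrite ltr_pM2r ?invr_gt0 ?ltr0n // ltr_nat.
- by move=> j'; rewrite mul0r mulr0 subr0; exact: jmin.
- by move=> i'; rewrite divff ?pnatr_eq0 // mulr1 subKr; exact: imax.
Qed.

(** Cauchy-Schwarz for the weights w, in the form that the Schur test needs:
    expand 0 <= sum_j w_j / th_j * (v_j - c th_j)^2 at c = (sum_j w_j v_j) / h.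
    Bounding sum_j w_j th_j by a positive h avoids the degenerate case w = 0. *)
Lemma weighted_cauchy_schwarz (R : realFieldType) (I : finType)
    (w v th : I -> R) (h : R) :
    (forall j, 0 <= w j) -> (forall j, 0 < th j) -> 0 < h ->
    \sum_j w j * th j <= h ->
  (\sum_j w j * v j) ^+ 2 / h <= \sum_j w j / th j * v j ^+ 2.
Proof.
move=> w0 th0 h0 wh; set T := \sum_j w j * v j; pose c := T / h.
have sq0 : 0 <= \sum_j w j / th j * (v j - c * th j) ^+ 2.
  apply: sumr_ge0 => j _.
  by rewrite mulr_ge0 ?sqr_ge0 // divr_ge0 ?w0 // ltW.
have sqE : \sum_j w j / th j * (v j - c * th j) ^+ 2 =
    \sum_j w j / th j * v j ^+ 2 - c * 2 * T + c ^+ 2 * \sum_j w j * th j.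
  rewrite !mulr_sumr -sumrB -big_split /=; apply: eq_bigr => j _.
  by field; rewrite gt_eqF.
have ch : c ^+ 2 * \sum_j w j * th j <= c ^+ 2 * h.
  by rewrite ler_wpM2l ?sqr_ge0.
have cT : c * T = T ^+ 2 / h by rewrite /c; field; rewrite gt_eqF.
have c2h : c ^+ 2 * h = T ^+ 2 / h by rewrite /c; field; rewrite gt_eqF.
by lra.
Qed.

(** The Schur test: Cauchy-Schwarz in each row, then exchange the sums. *)
Lemma schur_test (R : realFieldType) (m n : nat) (M : 'M[R]_(m, n))
    (th v : 'cV[R]_n) (h e : 'cV[R]_m) :
    (forall i j, 0 <= M i j) -> (forall j, 0 < th j 0) ->
    (forall i, 0 < h i 0) -> (forall i, 0 <= e i 0) ->
    (forall i, (M *m th) i 0 <= h i 0) ->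
  \sum_i e i 0 / h i 0 * (M *m v) i 0 ^+ 2 <=
    \sum_j (M^T *m e) j 0 / th j 0 * v j 0 ^+ 2.
Proof.
move=> M0 th0 h0 e0 Mh.
have rhsE : \sum_j (M^T *m e) j 0 / th j 0 * v j 0 ^+ 2 =
    \sum_i e i 0 * \sum_j M i j / th j 0 * v j 0 ^+ 2.
  under eq_bigr => j _ do rewrite mxE !mulr_suml.
  rewrite exchange_big /=; apply: eq_bigr => i _.
  by rewrite mulr_sumr; apply: eq_bigr => j _; rewrite mxE; ring.
rewrite rhsE; apply: ler_sum => i _.
have := Mh i; rewrite -mulrA !mxE => /weighted_cauchy_schwarz.
move=> /(_ (fun j => v j 0) (M0 i) th0 (h0 i)) cs.
by rewrite ler_wpM2l // mulrC.
Qed.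

Lemma qform_diag (R : realType) (n : nat) (p : 'rV[R]_n) (v : 'cV[R]_n) :
  qform (diag_mx p) v = \sum_i p 0 i * v i 0 ^+ 2.
Proof.
rewrite /qform -mulmxA mul_diag_mx mxE; apply: eq_bigr => i _.
by rewrite !mxE; ring.
Qed.

Lemma sum_wsqr_gt0 (R : realFieldType) (n : nat) (p : 'I_n -> R)
    (v : 'cV[R]_n) :
  (forall i, 0 < p i) -> v != 0 -> 0 < \sum_i p i * v i 0 ^+ 2.
Proof.
move=> p0 v0; have t0 i : 0 <= p i * v i 0 ^+ 2.
  by rewrite mulr_ge0 ?sqr_ge0 // ltW.
rewrite lt_neqAle sumr_ge0 ?andbT; last by move=> i _; exact: t0.
apply: contra v0; rewrite eq_sym psumr_eq0 => [/allP z|i _]; last exact: t0.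
apply/eqP/colP => i; rewrite mxE; apply/eqP.
have := z i (mem_index_enum i); rewrite /= mulf_eq0 gt_eqF //=.
by rewrite sqrf_eq0.
Qed.

Lemma posdef_diag_mx (R : realType) (n : nat) (p : 'rV[R]_n) :
  (forall i, 0 < p 0 i) -> posdef_diag (diag_mx p).
Proof.
move=> p0; split; first exact: diag_mx_is_diag.
by move=> v v0; rewrite qform_diag; apply: (@sum_wsqr_gt0 _ _ (p 0)).
Qed.

Lemma submxcol_history (R : realType) (n l : nat) (x : int -> 'cV[R]_n)
    (k : nat) (i : 'I_l.+1) :
  submxcol (history l x k) i = x (k%:Z - i%:Z).
Proof. exact: mxcolK. Qed.

Lemma history_neq0 (R : realType) (n l : nat) (x : int -> 'cV[R]_n) (k : nat) :
  history l x k != 0 -> exists i : 'I_l.+1, x (k%:Z - i%:Z) != 0.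
Proof.
move=> h0; apply/existsP; apply: contraNT h0 => /existsPn z.
apply/eqP; rewrite -mxcol0; apply: eq_mxcol => i.
by have := z i; rewrite negbK => /eqP.
Qed.

(** Passing from time k to k+1 shifts the delayed terms by one, so the
    difference of the functional pairs c(m+1) with c(m) on x(k-m).  The
    bound on the new state is phrased so that this pairing also covers the two
    ends: the term of P^(sigma(k)) at x(k) is cut down to the weight c(0), and
    x(k-l), which drops out of the functional, reappears with c(l+1). *)
Lemma LKfun_decrease (R : realType) (n N l : nat) (P : 'I_N -> 'rV[R]_n)
    (c : 'I_n -> nat -> R) (sigma : nat -> 'I_N) (x : int -> 'cV[R]_n)
    (k : nat) :
    (forall i m, c i m.+1 < c i m) ->
    \sum_i P (sigma k.+1) 0 i * x (k%:Z + 1) i 0 ^+ 2 <=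
      \sum_i (P (sigma k) 0 i - c i 0%N) * x k%:Z i 0 ^+ 2 +
      \sum_i c i l.+1 * x (k%:Z - l%:Z) i 0 ^+ 2 ->
    history l x k != 0 ->
  LKfun (fun s => diag_mx (P s)) (fun m : 'I_l => diag_mx (\row_i c i m.+1))
    sigma k.+1 (history l x k.+1) -
  LKfun (fun s => diag_mx (P s)) (fun m : 'I_l => diag_mx (\row_i c i m.+1))
    sigma k (history l x k) < 0.
Proof.
move=> cdec step /history_neq0[m0 xm0]; set V := LKfun _ _ _.
(* Two indices, because the weights c(m+1) go with x(k-m) at time k+1 and
   with x(k-m-1) at time k. *)
pose S (a b : nat) := \sum_i c i a * x (k%:Z - b%:Z) i 0 ^+ 2.
have V1 : V k.+1 (history l x k.+1) =
    \sum_i P (sigma k.+1) 0 i * x (k%:Z + 1) i 0 ^+ 2 + \sum_(m < l) S m.+1 m.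
  rewrite /V /LKfun submxcol_history qform_diag; congr (_ + _).
    by apply: eq_bigr => i _; congr (_ * x _ i 0 ^+ 2) => /=; lia.
  apply: eq_bigr => m _; rewrite submxcol_history qform_diag.
  apply: eq_bigr => i _; rewrite mxE; congr (_ * x _ i 0 ^+ 2).
  by rewrite lift0; lia.
have V0 : V k (history l x k) =
    \sum_i P (sigma k) 0 i * x k%:Z i 0 ^+ 2 + \sum_(m < l) S m.+1 m.+1.
  rewrite /V /LKfun submxcol_history qform_diag; congr (_ + _).
    by rewrite subr0.
  apply: eq_bigr => m _; rewrite submxcol_history qform_diag.
  by apply: eq_bigr => i _; rewrite mxE lift0.
have S00 : \sum_i (P (sigma k) 0 i - c i 0%N) * x k%:Z i 0 ^+ 2 =
    \sum_i P (sigma k) 0 i * x k%:Z i 0 ^+ 2 - S 0%N 0%N.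
  rewrite /S subr0 -sumrB; apply: eq_bigr => i _; exact: mulrBl.
have tele : \sum_(m < l.+1) S m.+1 m < \sum_(m < l.+1) S m m.
  have Sle (m : nat) : S m.+1 m <= S m m.
    by apply: ler_sum => i _; rewrite ler_wpM2r ?sqr_ge0 // ltW.
  rewrite (bigD1 m0) //= [ltRHS](bigD1 m0) //=.
  apply: ltr_leD; last by apply: ler_sum => m _; exact: Sle.
  rewrite -subr_gt0 /S -sumrB.
  under eq_bigr => i _ do rewrite -mulrBl.
  by apply: (@sum_wsqr_gt0 _ _ (fun i => _ - _)) => // i; rewrite subr_gt0.
move: tele; rewrite big_ord_recr [ltRHS]big_ord_recl /= => tele.
by rewrite V1 V0; move: step; rewrite S00 -/(S l.+1 l); lra.
Qed.

Theorem theorem6p2 (R : realType) (n N l : nat)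
  (n_gt0 : (0 < n)%N) (N_gt0 : (0 < N)%N) (l_gt0 : (0 < l)%N)
  (A B : 'I_N -> 'M[R]_n)
  (A_ge0 : forall s, nonneg_mx (A s)) (B_ge0 : forall s, nonneg_mx (B s))
  (f : 'cV[R]_n -> 'cV[R]_n) (f_adm : admissible f)
  (hyp : exists (mu lambda : R) (d : 'I_N -> 'cV[R]_n) (theta : 'cV[R]_n),
    [/\ 0 < mu /\ 0 < lambda,
        (forall s, vpos (d s)) /\ vpos theta,
        (forall s r m j : 'I_N,
          vle ((A s)^T *m d r + (B m)^T *m d j) (mu *: d s)),
        (forall s : 'I_N, vle ((A s + B s) *m theta) (lambda *: theta))
      & lambda * mu < 1]) :
  exists (P : 'I_N -> 'M[R]_n) (Q : 'I_l -> 'M[R]_n),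
    [/\ (forall s, posdef_diag (P s)),
        (forall m, posdef_diag (Q m))
      & is_switched_LK f A B (LKfun P Q)].
Proof.
case: hyp => mu [lam [d [th [[mu0 lam0] [d0 th0] Hd Hth lm1]]]].
case: f_adm => _ [phi [fE [_ phi_le]]].
pose s0 := Ordinal N_gt0.
pose a i (p : 'I_N * 'I_N) := lam * ((B p.1)^T *m d p.2) i 0.
pose b i (p : 'I_N * 'I_N) := d p.1 i 0 - lam * ((A p.1)^T *m d p.2) i 0.
have a0 i p : 0 <= a i p.
  rewrite mulr_ge0 ?(ltW lam0) // mxE sumr_ge0 // => j _.
  by rewrite mxE mulr_ge0 ?B_ge0 // ltW ?d0.
have ab i p q : a i p < b i q.
  have := Hd q.1 q.2 p.1 p.2 i.
  rewrite mxE [leRHS]mxE -(ler_pM2l lam0) mulrDr mulrA => le_lm.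
  rewrite ltrBrDl (le_lt_trans le_lm) // gtr_pMl //; exact: d0.
have [c cP] := choice (fun i =>
  @decreasing_between R _ _ (s0, s0) (s0, s0) (a i) (b i) l (ab i)).
have cdec i m m' : (m < m')%N -> c i m' < c i m by case: (cP i) => + _ _; apply.
have c0 i s r : c i 0%N <= b i (s, r) by case: (cP i).
have cl i m j : a i (m, j) <= c i l.+1 by case: (cP i).
have c_gt0 i m : (m <= l)%N -> 0 < c i m.
  move=> ml; apply: le_lt_trans (cdec i m l.+1 ml).
  exact: le_trans (a0 i (s0, s0)) (cl i s0 s0).
pose P s : 'rV[R]_n := \row_i (d s i 0 / th i 0).
pose ct i m := c i m / th i 0.
exists (fun s => diag_mx (P s)), (fun m => diag_mx (\row_i ct i m.+1)); split.
- move=> s; apply: posdef_diag_mx => i.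
  by rewrite mxE divr_gt0 ?d0 ?th0.
- move=> m; apply: posdef_diag_mx => i.
  by rewrite mxE divr_gt0 ?th0 // c_gt0.
move=> sigma k0 x xtraj k k0k xk0; apply: LKfun_decrease => //.
  by move=> i m; rewrite ltr_pM2r ?invr_gt0 ?th0 // cdec.
set s := sigma k; set r := sigma k.+1.
set y := x k%:Z; set z := x (k%:Z - l%:Z).
(* The sector condition lets f be dropped from the squares. *)
have fle : \sum_i P r 0 i * x (k%:Z + 1) i 0 ^+ 2 <=
    \sum_i P r 0 i * (A s *m y + B s *m z) i 0 ^+ 2.
  apply: ler_sum => i _.
  rewrite ler_wpM2l //; first by rewrite mxE ltW // divr_gt0 ?d0 ?th0.
  rewrite (xtraj k k0k) fE [X in X ^+ 2 <= _]mxE.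
  by rewrite -[leLHS]real_normK ?num_real // -[leRHS]real_normK ?num_real //
     lerXn2r ?nnegrE // phi_le.
apply: (le_trans fle).
(* Taking lam * d r as dual vector cancels the factor lam of the bound
   lam * theta, so the weights on the left are exactly those of P r. *)
have := @schur_test R _ _ (row_mx (A s) (B s)) (col_mx th th) (col_mx y z)
  (lam *: th) (lam *: d r).
have -> : \sum_i (lam *: d r) i 0 / (lam *: th) i 0 *
      (row_mx (A s) (B s) *m col_mx y z) i 0 ^+ 2 =
    \sum_i P r 0 i * (A s *m y + B s *m z) i 0 ^+ 2.
  apply: eq_bigr => i _; rewrite mul_row_col; congr (_ * _).
  by rewrite !mxE -mulf_div divff ?mul1r // gt_eqF.
move=> /(_ _ _ _ _ _)/le_trans; apply.
- by move=> i j; rewrite mxE; case: splitP => j' _; [apply: A_ge0|apply: B_ge0].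
- by move=> j; rewrite mxE; case: splitP => j' _; apply: th0.
- by move=> i; rewrite mxE mulr_gt0 ?th0.
- by move=> i; rewrite mxE mulr_ge0 ?(ltW lam0) // ltW // d0.
- by move=> i; rewrite mul_row_col -mulmxDl; exact: Hth.
rewrite big_split_ord /=.
under eq_bigr => i _ do rewrite !col_mxEu tr_row_mx mul_col_mx col_mxEu.
under [X in _ + X]eq_bigr => i _ do
  rewrite !col_mxEd tr_row_mx mul_col_mx col_mxEd.
have thV i : 0 <= (th i 0)^-1 by rewrite invr_ge0 ltW ?th0.
apply: lerD; apply: ler_sum => i _; rewrite ler_wpM2r ?sqr_ge0 //.
  rewrite [P _ _ _]mxE -mulrBl ler_wpM2r // -scalemxAr mxE lerBrDr addrC -lerBrDr.
  exact: c0.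
rewrite ler_wpM2r // -scalemxAr mxE.
exact: cl.
Qed.
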